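(* Let $T>0$, $I=[0,T]$, and let $\kappa\in\mathscr{K}_{\mathrm{reg}}$ (a regular admissible kernel) and $\Lambda\in\mathscr{A}(I)$ (an adaptive sensitivity function) be arbitrary. For any fixed $t_\star\in(0,T)$, define $f_{t_\star}:I\to\mathbb{R}$ by $f_{t_\star}(t)=1$ for $0\le t\le t_\star$ and $f_{t_\star}(t)=0$ for $t_\star<t\le T$. Then $f_{t_\star}$ is discontinuous at $t=t_\star$ (hence $f_{t_\star}\notin\mathcal{C}(I)$), yet $f_{t_\star}\in\mathscr{M}_{\kappa,\Lambda}(I)$; i.e. $S_{\kappa,\Lambda}(f_{t_\star})$ is well-defined and finite.
   Context: Fix $T>0$ and $I=[0,T]$. $\mathcal{C}(I)$ is the set of continuous functions $I\to\mathbb{R}$. Regular admissible kernels: $\mathscr{K}_{\mathrm{reg}}$ is the set of Lebesgue measurable, integrable functions $\kappa:I\to[0,\infty)$ such that (uniform boundedness) there are constants $0<m_\kappa\le M_\kappa<\infty$ with $m_\kappa\le\kappa(\tau)\le M_\kappa$ for all $\tau\in I$; (normalization) $\int_0^T\kappa(\tau)\,d\tau=1$; (Lipschitz continuity) there is $L_\kappa>0$ with $|\kappa(\tau_1)-\kappa(\tau_2)|\le L_\kappa|\tau_1-\tau_2|$ for all $\tau_1,\tau_2\in I$. Adaptive sensitivity functions: $\mathscr{A}(I)$ is the set of functions $\Lambda:I\times\mathbb{R}\to[0,\infty)$ such that: there are constants $0<\lambda_{\min}\le\lambda_{\max}<\infty$ with $\lambda_{\min}\le\Lambda(s,x)\le\lambda_{\max}$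 for all $(s,x)\in I\times\mathbb{R}$; there is $L_\Lambda>0$ with $|\Lambda(s,x)-\Lambda(s,y)|\le L_\Lambda|x-y|$ for all $s\in I$, $x,y\in\mathbb{R}$; for every fixed $x\in\mathbb{R}$, $s\mapsto\Lambda(s,x)$ is Lebesgue measurable on $I$; there is $\varrho>0$ with $\Lambda(s,0)\ge\varrho$ for all $s\in I$. Adaptive memory-dependent functional: for a function $f:I\to\mathbb{R}$ for which the integrals below exist as Lebesgue integrals for every $t\in I$, $$S_{\kappa,\Lambda}(f):=\sup_{t\in I}\left(|f(t)|+\int_0^t\Lambda(s,f(s))\,\kappa(t-s)\,|f(s)|\,ds\right).$$ Adaptive memory-dependent sensitivity set: $\mathscr{M}_{\kappa,\Lambda}(I):=\{f:I\to\mathbb{R}\mid S_{\kappa,\Lambda}(f)<\infty\}$, i.e. the set of functions for which $S_{\kappa,\Lambda}(f)$ is well-defined (the integrals exist as Lebesgue integrals) and finite. *)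

(* Defs.v *)
From HB Require Import structures.
From mathcomp Require Import all_boot all_order all_algebra.
From mathcomp Require Import all_classical all_reals all_analysis.

Set Implicit Arguments.
Unset Strict Implicit.
Unset Printing Implicit Defensive.

Import Order.TTheory GRing.Theory Num.Theory.
Import numFieldNormedType.Exports.

Local Open Scope classical_set_scope.
Local Open Scope ring_scope.

(* A function on I = [0, T] is represented by a function on R, of which only
   the values on `[0, T] are ever used.

   lebesgueType R is the line equipped with the Lebesgue (Caratheodory)
   sigma-algebra, i.e. the one on which completed_lebesgue_measure is defined;
   it is strictly finer than the Borel sigma-algebra carried by R itself. *)
Definition lebesgueType (R : realType) :=
  caratheodory_type ((wlength (@idfun R))^*)%mu.

Definition lebesgue_measurable_fun (R : realType) (D : set R) (f : R -> R) :=
  @measurable_fun _ _ (lebesgueType R) R D f.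

Section Definitions.
Context {R : realType}.
Implicit Types (T : R) (kappa f : R -> R) (Lambda : R -> R -> R).

Local Notation leb := (@completed_lebesgue_measure R).

Record regular_kernel T kappa : Prop := RegularKernel {
  kernel_ge0 : forall tau : R, tau \in `[0, T] -> 0 <= kappa tau;
  kernel_measurable : lebesgue_measurable_fun `[0, T] kappa;
  kernel_integrable : leb.-integrable `[0, T] (EFin \o kappa);
  kernel_bounded : exists m M : R, [/\ 0 < m, m <= M &
    forall tau : R, tau \in `[0, T] -> m <= kappa tau <= M];
  kernel_normalized : (\int[leb]_(tau in `[0%R, T]) (kappa tau)%:E = 1)%E;
  kernel_lipschitz : exists2 L : R, 0 < L &
    forall tau1 tau2 : R, tau1 \in `[0, T] -> tau2 \in `[0, T] ->
      `|kappa tau1 - kappa tau2| <= L * `|tau1 - tau2| }.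

Record adaptive_sensitivity T Lambda : Prop := AdaptiveSensitivity {
  sensitivity_ge0 : forall s x : R, s \in `[0, T] -> 0 <= Lambda s x;
  sensitivity_bounded : exists lmin lmax : R, [/\ 0 < lmin, lmin <= lmax &
    forall s x : R, s \in `[0, T] -> lmin <= Lambda s x <= lmax];
  sensitivity_lipschitz : exists2 L : R, 0 < L &
    forall s x y : R, s \in `[0, T] ->
      `|Lambda s x - Lambda s y| <= L * `|x - y|;
  sensitivity_measurable : forall x,
    lebesgue_measurable_fun `[0, T] (fun s => Lambda s x);
  sensitivity_gt0 : exists2 rho : R, 0 < rho &
    forall s : R, s \in `[0, T] -> rho <= Lambda s 0 }.

Definition memory_integrand kappa Lambda f (t s : R) : R :=
  Lambda s (f s) * kappa (t - s) * `|f s|.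

Definition memory_well_defined T kappa Lambda f : Prop :=
  forall t : R, t \in `[0, T] ->
    leb.-integrable `[0, t] (EFin \o memory_integrand kappa Lambda f t).

Definition memory_functional T kappa Lambda f : \bar R :=
  ereal_sup [set (`|f t|%:E +
    \int[leb]_(s in `[0%R, t]) (memory_integrand kappa Lambda f t s)%:E)%E
    | t in `[0, T]].

Definition memory_set T kappa Lambda : set (R -> R) :=
  [set f | memory_well_defined T kappa Lambda f /\
           (memory_functional T kappa Lambda f < +oo)%E].

Definition continuous_functions T : set (R -> R) :=
  [set f | {within `[0, T], continuous f}].

Definition continuous_in_at T f (t : R) : Prop :=
  {for (t : subspace `[0, T]), continuous (f : subspace `[0, T] -> R)}.

Definition step_function (tstar : R) : R -> R :=
  fun t => if t <= tstar then 1 else 0.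

End Definitions.

(* Main.v *)
Require Import Defs.
From mathcomp Require Import all_boot all_order all_algebra.
From mathcomp Require Import all_classical all_reals all_analysis.
From mathcomp Require Import measurable_realfun.

Import Order.TTheory GRing.Theory Num.Theory.
Import numFieldNormedType.Exports.

Local Open Scope classical_set_scope.
Local Open Scope ring_scope.

(** Measurability and boundedness suffice for membership in the memory set, so
    a jump does no harm: on a bounded interval a bounded measurable integrand
    is integrable, and when both |f| and the integrand are bounded
    uniformly in t, so is the functional; this is bounded_memory_set.

    For the step function the integrand is
    Lambda(s, 1) kappa(t - s) 1_{s <= tstar}, bounded by the product of the
    upper bounds of Lambda and kappa.  Its measurability
    (memory_integrand_step_measurable) is where the particular shape of f
    helps: because f takes only the values 0 and 1, the composite Lambda(s, f(s))
    is replaced by the section Lambda(., 1), measurable by assumption.  The lag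
    factor s |-> kappa(t - s) is handled through the Lipschitz condition, which
    makes it continuous, hence Borel, rather than through the invariance of
    Lebesgue measurable sets under reflection and translation.

    The discontinuity is the unit jump on the right of tstar, visible inside
    [0, T] because tstar < T. *)

Lemma step_function_discontinuous (R : realType) (T tstar : R) :
  0 <= tstar < T -> ~ continuous_in_at T (step_function tstar) tstar.
Proof.
move=> /andP[t0 tT] ct.
have tI : [set` `[0, T]] tstar by rewrite /= in_itv/= t0 ltW.
have : \forall s \near within [set` `[0, T]] (nbhs tstar),
    `|step_function tstar tstar - step_function tstar s| < 1.
  rewrite (nbhs_subspace_in tI).
  by move/cvgrPdist_lt : ct => /(_ 1 ltr01).
rewrite near_withinE => near_lt1.
near tstar^'+ => s.
have ts : tstar < s by [].
have : `|step_function tstar tstar - step_function tstar s| < 1.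
  have sI : [set` `[0, T]] s.
    by rewrite /= in_itv/= (le_trans t0 (ltW ts))/=; near: s; exact: nbhs_right_le.
  by move: sI; near: s; exact: cvg_within.
by rewrite /step_function lexx leNgt ts/= subr0 normr1 ltxx.
Unshelve. all: by end_near. Qed.

Lemma lipschitz_within_continuous (R : realType) (A : set R) (L : R)
    (f : R -> R) :
  0 < L -> (forall x y, A x -> A y -> `|f x - f y| <= L * `|x - y|) ->
  {within A, continuous f}.
Proof.
move=> L0 fL; apply/subspace_continuousP => x Ax.
apply/cvgrPdist_lt => e e0.
rewrite near_withinE; near=> y => Ay.
apply: le_lt_trans (fL _ _ Ax Ay) _.
rewrite mulrC -ltr_pdivlMr//; near: y.
by apply: (@cvgr_dist_lt _ R) => //; rewrite divr_gt0.
Unshelve. all: by end_near. Qed.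

(** The Borel sets are generated by the half-open intervals, which satisfy the
    Caratheodory criterion for the outer measure extending interval length. *)
Lemma borel_lebesgue_measurable (R : realType) (A : set R) :
  measurable A -> measurable (A : set (lebesgueType R)).
Proof. exact: (@sub_caratheodory _ _ _ (@wlength R idfun)). Qed.

Lemma borel_lebesgue_measurable_fun (R : realType) (D : set R) (f : R -> R) :
  measurable D -> measurable_fun D f -> lebesgue_measurable_fun D f.
Proof.
by move=> mD mf _ Y mY; apply: borel_lebesgue_measurable; exact: mf.
Qed.

(** Both Lebesgue measures are the same outer measure, restricted to different
    sigma-algebras, so the value is inherited from the Borel one. *)
Lemma completed_lebesgue_measure_itv (R : realType) (a b : R) : a <= b ->
  completed_lebesgue_measure [set` `[a, b]] = (b - a)%:E.
Proof.
(* The two sides are convertible: both unfold to the outer measure. *)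
move=> ab; transitivity (@lebesgue_measure R [set` `[a, b]]) => //.
rewrite lebesgue_measure_itv/= lte_fin; case: ltgtP ab => // ->.
by rewrite subrr.
Qed.

(** For s in [0, t] the lag t - s stays in [0, T], where kappa is Lipschitz;
    the reflection s |-> t - s is an isometry and keeps the constant. *)
Lemma kernel_lag_measurable (R : realType) (T t : R) (kappa : R -> R) :
  regular_kernel T kappa -> t \in `[0, T] ->
  lebesgue_measurable_fun [set` `[0, t]] (fun s => kappa (t - s)).
Proof.
move=> [_ _ _ _ _ [L L0 kL]]; rewrite in_itv/= => /andP[t0 tT].
have lagI s : s \in `[0, t] -> t - s \in `[0, T].
  by rewrite !in_itv/= subr_ge0 lerBlDr => /andP[s0 ->]; rewrite ler_wpDr.
apply: borel_lebesgue_measurable_fun; first exact: measurable_itv.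
apply: subspace_continuous_measurable_fun; first exact: measurable_itv.
apply: (lipschitz_within_continuous _ _ L) => // x y xt yt.
have -> : `|x - y| = `|(t - x) - (t - y)|.
  by rewrite opprB [in RHS]addrC addrA subrK distrC.
exact: kL (lagI _ xt) (lagI _ yt).
Qed.

(** The factor |f(s)| vanishes wherever f(s) differs from 1, so Lambda(s, f(s))
    may be replaced by Lambda(s, 1) throughout. *)
Lemma memory_integrand_step (R : realType) (kappa : R -> R)
    (Lambda : R -> R -> R) (tstar t s : R) :
  memory_integrand kappa Lambda (step_function tstar) t s =
  Lambda s 1 * kappa (t - s) * \1_[set` `]-oo, tstar]] s.
Proof.
rewrite /memory_integrand /step_function indicE mem_setE in_itv/=.
by case: ifP; rewrite ?normr1// normr0 !mulr0.
Qed.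

Lemma memory_integrand_step_measurable (R : realType) (T t tstar : R)
    (kappa : R -> R) (Lambda : R -> R -> R) :
  regular_kernel T kappa -> adaptive_sensitivity T Lambda -> t \in `[0, T] ->
  lebesgue_measurable_fun [set` `[0, t]]
    (memory_integrand kappa Lambda (step_function tstar) t).
Proof.
move=> hk hL tI; rewrite /lebesgue_measurable_fun.
rewrite (funext (memory_integrand_step _ kappa Lambda tstar t)).
have m0T : measurable ([set` `[0, T]] : set (lebesgueType R)).
  by apply: borel_lebesgue_measurable; exact: measurable_itv.
apply: measurable_funM; last first.
  apply: measurable_indic; apply: borel_lebesgue_measurable.
  exact: measurable_itv.
apply: measurable_funM; last exact: kernel_lag_measurable hk tI.
apply: measurable_funS m0T _ (sensitivity_measurable hL 1).
by move: tI; rewrite in_itv/= => /andP[_ tT]; exact: subset_itvl.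
Qed.

(** Uniform bounds B on |f| and C on the integrand give the bound B + C T on
    the functional, the interval [0, t] having measure at most T. *)
Lemma bounded_memory_set (R : realType) (T B C : R) (kappa f : R -> R)
    (Lambda : R -> R -> R) :
  0 <= C ->
  (forall t, t \in `[0, T] -> `|f t| <= B) ->
  (forall t, t \in `[0, T] ->
    lebesgue_measurable_fun [set` `[0, t]] (memory_integrand kappa Lambda f t)) ->
  (forall t s, t \in `[0, T] -> s \in `[0, t] ->
    `|memory_integrand kappa Lambda f t s| <= C) ->
  memory_set T kappa Lambda f.
Proof.
move=> C0 fB mg gC.
have mI t : measurable ([set` `[0, t]] : set (lebesgueType R)).
  by apply: borel_lebesgue_measurable; exact: measurable_itv.
split => [t tI|].
  apply: measurable_bounded_integrable; [exact: mI| |exact: mg|].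
    move: tI; rewrite in_itv/= => /andP[t0 _].
    by rewrite [ltLHS](completed_lebesgue_measure_itv _ _ _ t0) ltry.
  exists C; split; first exact: num_real.
  by move=> D CD s sI; apply: le_trans (ltW CD); exact: gC.
apply: (@le_lt_trans _ _ (B + C * T)%:E); last exact: ltry.
apply: ub_ereal_sup => _ [t tI <-]; rewrite EFinD leeD ?lee_fin ?fB//.
have mE : measurable_fun ([set` `[0, t]] : set (lebesgueType R))
  (EFin \o memory_integrand kappa Lambda f t).
  by apply/measurable_EFinP; exact: mg.
apply: le_trans (lee_abs _) _.
apply: le_trans (le_abse_integral _ (mI t) mE) _.
apply: le_trans (integral_le_bound C%:E (mI t) mE _ _) _.
- by rewrite lee_fin.
- by apply: aeW => s sI; rewrite lee_fin gC.
move: tI; rewrite /= in_itv/= => /andP[t0 tT].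
rewrite [X in (_ * X)%E](completed_lebesgue_measure_itv _ _ _ t0) -EFinM lee_fin.
by rewrite subr0 ler_wpM2l.
Qed.

Theorem proposition4p2 (R : realType) (T : R) (kappa : R -> R)
    (Lambda : R -> R -> R) (tstar : R) (T_gt0 : 0 < T)
    (hkappa : regular_kernel T kappa)
    (hLambda : adaptive_sensitivity T Lambda)
    (htstar : 0 < tstar < T) :
  [/\ ~ continuous_in_at T (step_function tstar) tstar,
      ~ continuous_functions T (step_function tstar) &
      memory_set T kappa Lambda (step_function tstar)].
Proof.
have discont : ~ continuous_in_at T (step_function tstar) tstar.
  apply: step_function_discontinuous.
  by case/andP: htstar => /ltW -> ->.
split=> [//|/(_ tstar)//|].
have [m [M [m0 mM kM]]] := kernel_bounded hkappa.
have [l [K [l0 lK LK]]] := sensitivity_bounded hLambda.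
have K0 : 0 <= K by rewrite (le_trans (ltW l0)).
have M0 : 0 <= M by rewrite (le_trans (ltW m0)).
(* The step function is at most 1, the integrand at most sup Lambda * sup kappa. *)
apply: (@bounded_memory_set _ _ 1 (K * M)).
- exact: mulr_ge0.
- by move=> t _; rewrite /step_function; case: ifP; rewrite ?normr1 ?normr0.
- by move=> t tI; exact: memory_integrand_step_measurable hkappa hLambda tI.
move=> t s; rewrite !in_itv/= => /andP[t0 tT] /andP[s0 st].
have sI : s \in `[0, T] by rewrite in_itv/= s0 (le_trans st).
have tsI : t - s \in `[0, T].
  by rewrite in_itv/= subr_ge0 st/= lerBlDr ler_wpDr.
have k0 := kernel_ge0 hkappa tsI; have L0 := sensitivity_ge0 hLambda 1 sI.
have /andP[_ kM'] := kM _ tsI; have /andP[_ LK'] := LK _ 1 sI.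
rewrite memory_integrand_step indicE normrM ger0_norm ?mulr_ge0//.
apply: le_trans (ler_pM _ _ LK' kM') => //.
by rewrite ler_piMr ?mulr_ge0//; case: (_ \in _); rewrite ?normr1 ?normr0.
Qed.
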